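(* Let $1\le s,q,r<\infty$ with $q<s$ and $r\le s$. The correspondence $X \mapsto \ell^{A}_{(s,q,r)}(X)$, which assigns to each Banach space $X$ the space $\ell^{A}_{(s,q,r)}(X)$ with the norm $\|\cdot\|_{A(s,q,r)}$, is a linearly stable and finitely determined sequence class.
   Context: Banach spaces are over $\mathbb{K}=\mathbb{R}$ or $\mathbb{C}$; $B_X$ is the closed unit ball of $X$, $X^*$ its topological dual, $\mathcal{L}(U;X)$ the Banach space of continuous linear operators from $U$ to $X$. $\ell_r(X)$ is the space of absolutely $r$-summable $X$-valued sequences with its usual norm, $\ell_\infty(X)$ that of bounded $X$-valued sequences with the sup norm, $c_{00}(X)$ that of eventually null $X$-valued sequences. The space $\ell^{A}_{(s,q,r)}(X)$ consists of all sequences $(x_j)_{j=1}^\infty$ in $X$ such that $\sum_{j=1}^\infty\left(\sum_{k=1}^\infty|x_k^*(x_j)|^s\right)^{q/s}<\infty$ for every $(x_k^* )_{k=1}^\infty\in\ell_r(X^* )$, with the norm $$\|(x_j)_{j=1}^\infty\|_{A(s,q,r)}=\sup_{(x_k^* )_k\in B_{\ell_r(X^* )}}\left(\sum_{j=1}^\infty\left(\sum_{k=1}^\infty|x_k^*(x_j)|^s\right)^{q/s}\right)^{1/q}.$$ A sequence class $\mathcal{X}$ is a rule that assigns to each Banach space $E$ a Banach space $\mathcal{X}(E)$ of $E$-valued sequences (a vector subspace of $E^{\mathbb{N}}$ with the coordinatewise operations) such that $c_{00}(E)\subseteq\mathcal{X}(E)\subseteq\ell_\infty(E)$, $\|x\|_{\ell_\infty(E)}\le\|x\|_{\mathcal{X}(E)}$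 for every $x\in\mathcal{X}(E)$, and $\|e_j\|_{\mathcal{X}(\mathbb{K})}=1$ for every $j$, where $e_j$ is the scalar sequence with $1$ in the $j$-th entry and $0$ elsewhere. A sequence class $\mathcal{X}$ is finitely determined if for every Banach space $E$ and every $(x_j)_{j=1}^\infty\in E^{\mathbb{N}}$: $(x_j)_{j=1}^\infty\in\mathcal{X}(E)$ if and only if $\sup_n\|(x_j)_{j=1}^n\|_{\mathcal{X}(E)}<\infty$, and in this case $\|(x_j)_{j=1}^\infty\|_{\mathcal{X}(E)}=\sup_n\|(x_j)_{j=1}^n\|_{\mathcal{X}(E)}$ (finite sequences being extended by zeros). A sequence class $\mathcal{X}$ is linearly stable if for all Banach spaces $U,X$ and every $u\in\mathcal{L}(U;X)$ one has $(u(x_j))_{j=1}^\infty\in\mathcal{X}(X)$ whenever $(x_j)_{j=1}^\infty\in\mathcal{X}(U)$, and the induced operator $\widehat{u}:\mathcal{X}(U)\to\mathcal{X}(X)$, $\widehat{u}((x_j)_{j=1}^\infty)=(u(x_j))_{j=1}^\infty$, is continuous with $\|\widehat{u}\|=\|u\|$. *)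

(* Defs.v *)
From HB Require Import structures.
From mathcomp Require Import all_boot all_order all_algebra.
From mathcomp Require Import complex.
From mathcomp Require Import all_classical all_reals all_analysis.

Set Implicit Arguments.
Unset Strict Implicit.
Unset Printing Implicit Defensive.

Import Order.TTheory GRing.Theory Num.Theory.
Import numFieldNormedType.Exports.
Local Open Scope classical_set_scope.
Local Open Scope ring_scope.

Variant scalar_kind := RealScalars | ComplexScalars.

Definition scalars (R : realType) (k : scalar_kind) : numFieldType :=
  match k with
  | RealScalars => (R : numFieldType)
  | ComplexScalars => (R[i] : numFieldType)
  end.

(* MathComp-Analysis norms take their values in the scalar field; [rpart] reads
   these (real, nonnegative) values back in [R]. *)
Definition rpart (R : realType) (k : scalar_kind) : scalars R k -> R :=
  match k with
  | RealScalars => fun x : R => x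
  | ComplexScalars => fun z : R[i] => complex.Re z
  end.

Definition rnorm (R : realType) (k : scalar_kind)
    (E : normedModType (scalars R k)) (x : E) : R := rpart `|x|.

(* An alias of the scalar field, to carry its structure of Banach space. *)
Definition kspace (R : realType) (k : scalar_kind) : Type := (scalars R k)^o.

HB.instance Definition _ (R : realType) (k : scalar_kind) :=
  NormedModule.copy (kspace R k) (scalars R k)^o.

Lemma normc_le_ReIm (R : realType) (z : R[i]) :
  `|z| <= (`|complex.Re z| + `|complex.Im z|)%:C%C.
Proof.
rewrite normc_def lecR -(ler_pXn2r (n := 2)) ?nnegrE ?addr_ge0 ?sqrtr_ge0//.
rewrite sqr_sqrtr ?addr_ge0 ?sqr_ge0// sqrrD !real_normK ?num_real//.
by rewrite lerD2r lerDl mulrn_wge0 ?mulr_ge0.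
Qed.

Lemma normc_ge_Im (R : realType) (z : R[i]) : `|complex.Im z|%:C%C <= `|z|.
Proof.
rewrite normc_def lecR -sqrtr_sqr ler_wsqrtr// lerDr sqr_ge0//.
Qed.

Lemma complex_complete (R : realType) (F : set_system R[i]^o) :
  ProperFilter F -> cauchy F -> cvg F.
Proof.
move=> FF /cauchy_ballP Fc.
have comp (p : R[i] -> R) : {morph p : x y / x - y} ->
    (forall z, `|p z|%:C%C <= `|z|) -> exists a : R, p @ F --> a.
  move=> pB ple; apply/cvg_ex; apply: R_complete; apply/cauchyP => e e0.
  have e0' : 0 < e%:C%C :> R[i] by rewrite ltcR.
  have /cauchy_ballP/cauchyP/(_ _ e0')[z Fz] := Fc.
  exists (p z); change (F (p @^-1` ball (p z) e)).
  apply: filterS Fz => w; rewrite -!ball_normE /ball_/= => zw.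
  by rewrite -pB -ltcR; exact: le_lt_trans (ple _) zw.
have [a Fa] := comp (@complex.Re R) ltac:(by move=> [? ?] [? ?]) (@normc_ge_Re _).
have [b Fb] := comp (@complex.Im R) ltac:(by move=> [? ?] [? ?]) (@normc_ge_Im R).
apply/cvg_ex; exists (a +i* b)%C; apply/cvgrPdist_lt => e e0.
have [eI eR0] : complex.Im e = 0 /\ 0 < complex.Re e.
  by move: e0; rewrite ltcE => /andP[/eqP].
have eE : e = (complex.Re e)%:C%C by move: (e) eI => [? ?] /= ->.
have e20 : 0 < complex.Re e / 2 by rewrite divr_gt0.
have dist_lt (p : R[i] -> R) (c : R) : p @ F --> c ->
    \forall z \near F, `|c - p z| < complex.Re e / 2.
  move=> /cvg_ball/(_ _ e20) /=; rewrite -ball_normE; exact.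
near=> z.
apply: le_lt_trans (normc_le_ReIm _) _; rewrite eE ltcR.
rewrite (splitr (complex.Re e)) !raddfB ltrD//=.
- by near: z; exact: dist_lt Fa.
- by near: z; exact: dist_lt Fb.
Unshelve. all: by end_near. Qed.

Lemma kspace_complete (R : realType) (k : scalar_kind)
    (F : set_system (kspace R k)) : ProperFilter F -> cauchy F -> cvg F.
Proof.
by case: k F => F FF Fc; [exact: (@R_complete R F) | exact: complex_complete].
Qed.

HB.instance Definition _ (R : realType) (k : scalar_kind) :=
  Uniform_isComplete.Build (kspace R k) (@kspace_complete R k).

Section SequenceClasses.
Variables (R : realType) (k : scalar_kind).
Local Notation K := (scalars R k).
Local Notation banach := (completeNormedModType K).

Record clinear (U V : banach) : Type := CLinear {
  clinear_fun :> {linear U -> V};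
  clinear_continuous : continuous clinear_fun
}.

Definition dual (E : banach) := clinear E (kspace R k).

Local Open Scope ereal_scope.

Definition opnorm (U V : banach) (u : clinear U V) : \bar R :=
  ereal_sup [set (rnorm (u x))%:E | x in [set x : U | (rnorm x <= 1)%R]].

Definition c00 (E : banach) : set (nat -> E) :=
  [set x | exists n, forall j, (n <= j)%N -> x j = 0%R].

Arguments c00 : clear implicits.

Definition linfty_norm (E : banach) (x : nat -> E) : \bar R :=
  ereal_sup (range (fun j => (rnorm (x j))%:E)).

Definition linfty (E : banach) : set (nat -> E) :=
  [set x | linfty_norm x < +oo].

Arguments linfty : clear implicits.

Definition unit_seq (j : nat) : nat -> kspace R k :=
  fun i => (i == j)%:R%R : K.

Definition truncate (E : banach) (x : nat -> E) (n : nat) : nat -> E :=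
  fun j => if (j < n)%N then x j else 0%R.

(* The norm carried by a sequence through an injection [f] of a Banach space
   into [nat -> E], extended by [+oo] outside the range of [f]. *)
Definition seq_norm (E B : banach) (f : B -> nat -> E) (x : nat -> E) : \bar R :=
  ereal_inf [set (rnorm v)%:E | v in [set v | f v = x]].

(* [sc_space E] is the Banach space of E-valued sequences assigned to [E], and
   the injection [sc_val E] reads its elements as sequences. *)
Record sequence_class : Type := SequenceClass {
  sc_space : banach -> banach;
  sc_val : forall E : banach, {linear sc_space E -> (nat -> E)};
  sc_val_inj : forall E, injective (sc_val E);
  sc_c00 : forall E, c00 E `<=` range (sc_val E);
  sc_linfty : forall E, range (sc_val E) `<=` linfty E;
  sc_linfty_norm : forall E (v : sc_space E),
    linfty_norm (sc_val E v) <= (rnorm v)%:E;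
  sc_unit_norm : forall j, seq_norm (sc_val (kspace R k)) (unit_seq j) = 1
}.

Definition finitely_determined (X : sequence_class) : Prop :=
  forall (E : banach) (x : nat -> E),
    let N := seq_norm (sc_val X E) in
    (range (sc_val X E) x <-> ereal_sup (range (N \o truncate x)) < +oo) /\
    (range (sc_val X E) x -> N x = ereal_sup (range (N \o truncate x))).

Definition linearly_stable (X : sequence_class) : Prop :=
  forall (U V : banach) (u : clinear U V),
    exists uhat : clinear (sc_space X U) (sc_space X V),
      (forall v j, sc_val X V (uhat v) j = u (sc_val X U v j)) /\
      opnorm uhat = opnorm u.

(* The norm of [phi] in l_r(E^* ), [+oo] when [phi] is not r-summable. *)
Definition ell_dual_norm (r : R) (E : banach) (phi : nat -> dual E) : \bar R :=
  (\sum_(i <oo) (opnorm (phi i) `^ r)) `^ r^-1.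

Definition ellA_sum (s q : R) (E : banach) (phi : nat -> dual E)
    (x : nat -> E) : \bar R :=
  \sum_(j <oo) (\sum_(i <oo) (rnorm (phi i (x j)) `^ s)%:E) `^ (q / s).

Definition ellA (s q r : R) (E : banach) : set (nat -> E) :=
  [set x | forall phi : nat -> dual E,
     ell_dual_norm r phi < +oo -> ellA_sum s q phi x < +oo].

Definition ellA_norm (s q r : R) (E : banach) (x : nat -> E) : \bar R :=
  ereal_sup [set ellA_sum s q phi x `^ q^-1 |
    phi in [set phi : nat -> dual E | ell_dual_norm r phi <= 1]].

End SequenceClasses.

Arguments c00 {R k} E.
Arguments linfty {R k} E.
Arguments ellA {R k} s q r E.

(* Main.v *)
Require Import Defs.
From HB Require Import structures.
From mathcomp Require Import all_boot all_order all_algebra.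
From mathcomp Require Import complex lra ring.
From mathcomp Require Import all_classical all_reals all_analysis.
Set Implicit Arguments.
Unset Strict Implicit.
Unset Printing Implicit Defensive.
Import Order.TTheory GRing.Theory Num.Theory.
Import numFieldNormedType.Exports.
Local Open Scope classical_set_scope.
Local Open Scope ring_scope.

(** The argument is split by an interface: [seq_normed] lists properties of an extended norm,
    defined on all sequences, from which a finitely determined sequence class follows, and the
    anisotropic norms are then shown to satisfy them. Working with values in [\bar R] keeps
    summability out of every inequality. The condition [r <= s] enters through the inclusion of the
    unit ball of l_r in that of l_s: it bounds the norm of a vector placed at one coordinate by the
    norm of that vector. This gives the unit sequences norm 1 and shows that the induced operator is
    not smaller in norm than [u]. That it is not larger follows by composing functionals on the
    target with [u]. Real and complex scalars are treated together by viewing every space as a real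
    one through [ofR]; they separate only where a real functional must become scalar-linear. *)

(* The norm is a supremum of mixed l_q(l_s) norms of (x_i^*(x_j)), so the
   triangle inequality is Minkowski applied twice; it controls the coordinates
   by Hahn-Banach, and it is the supremum of its values on truncations, which
   gives lower semicontinuity under coordinatewise convergence, hence both
   completeness and finite determination. The supremum is finite as soon as all
   the sums are: otherwise countably many sequences of functionals with rapidly
   growing sums could be scaled and interleaved into one r-summable sequence
   with an infinite sum. *)

(** * l_p norms of sequences of extended reals *)

Section Lpnorm.
Context {R : realType}.
Implicit Types (p r s c : R) (a b : nat -> \bar R).
Local Open Scope ereal_scope.

Lemma lee_poweR r (x y : \bar R) : (0 <= r)%R -> 0 <= x -> x <= y ->
  x `^ r <= y `^ r.
Proof.
move=> r0 x0 xy; apply: gt0_ler_poweR => //; rewrite in_itv/= leey andbT//.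
exact: le_trans xy.
Qed.

Lemma poweRK p (x : \bar R) : (0 < p)%R -> 0 <= x -> (x `^ p) `^ p^-1 = x.
Proof. by move=> p0 x0; rewrite -poweRrM mulfV ?gt_eqF// poweRe1. Qed.

Lemma poweRVK p (x : \bar R) : (0 < p)%R -> 0 <= x -> (x `^ p^-1) `^ p = x.
Proof. by move=> p0 x0; rewrite -poweRrM mulVf ?gt_eqF// poweRe1. Qed.

Lemma nneseries_ge_term a i : (forall n, 0 <= a n) -> a i <= \sum_(n <oo) a n.
Proof.
move=> a0; apply: le_trans (nneseries_lim_ge i.+1 _) => //.
by rewrite big_nat_recr//= leeDr// sume_ge0.
Qed.

Lemma nneseries_single a j : (forall n, n != j -> a n = 0) ->
  \sum_(n <oo) a n = a j.
Proof.
move=> aj; apply/lim_near_cst => //; near=> n.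
have jn : (j < n)%N by near: n; exists j.+1.
rewrite big_mkord (bigD1 (Ordinal jn))//= big1 ?adde0// => i.
by rewrite -val_eqE /= => /aj.
Unshelve. all: by end_near. Qed.

Lemma nneseries_supE a : (forall n, 0 <= a n) ->
  \sum_(n <oo) a n = ereal_sup (range (fun n => \sum_(i < n) a i)).
Proof.
move=> a0; apply/cvg_lim => //.
rewrite (_ : (fun n => \sum_(i < n) a i) = fun n => \sum_(0 <= i < n) a i);
  last by apply/funext => n; rewrite big_mkord.
by apply: ereal_nondecreasing_cvgn; exact: ereal_nondecreasing_series.
Qed.

(** With nonnegative terms both sides are unordered sums, hence equal for any enumeration [e] of the
    pairs. *)
Lemma nneseries_pair (e : nat -> nat * nat) (f : nat * nat -> \bar R) :
  bijective e -> (forall m, 0 <= f m) ->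
  \sum_(m <oo) f (e m) = \sum_(n <oo) \sum_(k <oo) f (n, k).
Proof.
move=> ebij f0.
rewrite nneseries_esumT; last by move=> n; exact: f0.
under [RHS]eq_eseriesr => i _.
  rewrite nneseries_esumT; last by move=> n; exact: f0.
  over.
rewrite nneseries_esumT; last by move=> n; apply: esum_ge0 => *; exact: f0.
rewrite esum_esum; last by move=> *; exact: f0.
rewrite (_ : _ `*`` _ = setT); last by apply/seteqP; split => // -[].
rewrite (reindex_esum setT setT e)//=.
- by apply: eq_esum => i _; case: (e i).
- case: ebij => g eg ge; split => //= [x y _ _ /(can_inj eg)|x _]//.
  by exists (g x).
Qed.

(** Entries may be [+oo], so that these norms can be nested without summability conditions. *)
Definition lpnorm p a := (\sum_(i <oo) (a i `^ p)) `^ p^-1.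

Lemma lpnorm_ge0 p a : 0 <= lpnorm p a.
Proof. exact: poweR_ge0. Qed.

Lemma lpnormX p a : (0 < p)%R -> lpnorm p a `^ p = \sum_(i <oo) (a i `^ p).
Proof.
by move=> p0; rewrite poweRVK//; apply: nneseries_ge0 => *; exact: poweR_ge0.
Qed.

Lemma le_lpnorm p a b : (0 <= p)%R -> (forall i, 0 <= a i) ->
  (forall i, a i <= b i) -> lpnorm p a <= lpnorm p b.
Proof.
move=> p0 a0 ab; apply: lee_poweR; first by rewrite invr_ge0.
  by apply: nneseries_ge0 => *; exact: poweR_ge0.
by apply: lee_nneseries => *; [exact: poweR_ge0|exact: lee_poweR].
Qed.

Lemma lpnormZ p c a : (0 < p)%R -> (0 <= c)%R -> (forall i, 0 <= a i) ->
  lpnorm p (fun i => c%:E * a i) = c%:E * lpnorm p a.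
Proof.
move=> p0 c0 a0; rewrite /lpnorm.
under eq_eseriesr do rewrite poweRM// poweR_EFin.
rewrite nneseriesZl; last by move=> *; exact: poweR_ge0.
rewrite poweRM ?lee_fin ?powR_ge0//; last first.
  by apply: nneseries_ge0 => *; exact: poweR_ge0.
by rewrite -poweR_EFin poweRK.
Qed.

Lemma lpnorm_ge_term p a i : (0 < p)%R -> (forall i, 0 <= a i) ->
  a i <= lpnorm p a.
Proof.
move=> p0 a0; rewrite -[leLHS](poweRK p0)//.
apply: lee_poweR; rewrite ?invr_ge0 ?poweR_ge0//; first exact: ltW.
by apply: (nneseries_ge_term (a := fun i => a i `^ p)) => n; exact: poweR_ge0.
Qed.

Lemma lpnorm_single p a j : (0 < p)%R -> (forall n, n != j -> a n = 0) ->
  0 <= a j -> lpnorm p a = a j.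
Proof.
move=> p0 aj aj0; rewrite /lpnorm (@nneseries_single _ j) ?poweRK//.
by move=> n /aj ->; rewrite poweR0r// gt_eqF.
Qed.

Lemma lpnormD p a b : (1 <= p)%R ->
  (forall i, 0 <= a i) -> (forall i, 0 <= b i) ->
  lpnorm p (fun i => a i + b i) <= lpnorm p a + lpnorm p b.
Proof.
move=> p1 a0 b0; have p0 : (0 < p)%R by exact: lt_le_trans p1.
(* An infinite entry makes the right-hand side [+oo]. Otherwise both sequences are real and the
   claim is Minkowski's inequality for the counting measure. *)
have [[i ai]|afin] := pselect (exists i, a i = +oo).
  rewrite [X in _ <= X + _](_ : _ = +oo); last first.
    by apply/eqP; rewrite -leye_eq -ai lpnorm_ge_term.
  by rewrite addye ?leey// gt_eqF// (lt_le_trans _ (lpnorm_ge0 _ _)).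
have [[i bi]|bfin] := pselect (exists i, b i = +oo).
  rewrite [X in _ <= _ + X](_ : _ = +oo); last first.
    by apply/eqP; rewrite -leye_eq -bi lpnorm_ge_term.
  by rewrite addey ?leey// gt_eqF// (lt_le_trans _ (lpnorm_ge0 _ _)).
have toR (c : nat -> \bar R) : (forall i, 0 <= c i) ->
    ~ (exists i, c i = +oo) -> c = EFin \o (fine \o c).
  move=> c0 cfin; apply/funext => i /=; rewrite fineK// ge0_fin_numE// ltey.
  by apply/eqP => ci; apply: cfin; exists i.
have lpE (c : nat -> \bar R) : (forall i, 0 <= c i) -> lpnorm p c =
    Lnorm counting p%:E c.
  move=> c0; rewrite Lnorm_counting// /lpnorm.
  by under [in RHS]eq_eseriesr do rewrite gee0_abs//.
rewrite !lpE//; last by move=> i; rewrite adde_ge0.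
rewrite (toR _ a0 afin) (toR _ b0 bfin).
rewrite [X in Lnorm _ _ X <= _](_ :
  _ = EFin \o ((fine \o a) \+ (fine \o b))%R)//.
exact: minkowski_EFin.
Qed.

(* Entries at most 1 have decreasing powers, so no normalisation is needed. *)
Lemma lpnorm_le1W r s a : (0 < r)%R -> (r <= s)%R -> (forall i, 0 <= a i) ->
  lpnorm r a <= 1 -> lpnorm s a <= 1.
Proof.
move=> r0 rs a0 a1; have s0 : (0 < s)%R by exact: lt_le_trans rs.
rewrite -(poweR1r s^-1); apply: lee_poweR.
- by rewrite invr_ge0 ltW.
- by apply: nneseries_ge0 => *; exact: poweR_ge0.
- apply: (@le_trans _ _ (lpnorm r a `^ r)); last first.
    by rewrite -[leRHS](poweR1r r); apply: lee_poweR a1;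
      [exact: ltW|exact: lpnorm_ge0].
  rewrite lpnormX//; apply: lee_nneseries => [*|i _]; first exact: poweR_ge0.
  have := le_trans (lpnorm_ge_term i r0 a0) a1.
  have := a0 i; case: (a i) => // x; rewrite !lee_fin => x0 x1.
  have [->|xn0] := eqVneq x 0%R; first by rewrite !powR0 ?gt_eqF.
  by apply: ger_powR => //; rewrite lt0r xn0 x0.
Qed.

Lemma lpnorm_le_truncate (p : R) (a : nat -> \bar R) (C : \bar R) : (0 < p)%R ->
  (forall i, 0 <= a i) ->
  (forall n, lpnorm p (fun i => if (i < n)%N then a i else 0) <= C) ->
  lpnorm p a <= C.
Proof.
move=> p0 a0 aC.
have C0 : 0 <= C by exact: le_trans (lpnorm_ge0 _ _) (aC 0%N).
rewrite -(poweRK p0 C0); apply: lee_poweR.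
- by rewrite invr_ge0 ltW.
- by apply: nneseries_ge0 => *; exact: poweR_ge0.
rewrite nneseries_supE; last by move=> *; exact: poweR_ge0.
apply: ge_ereal_sup => _ [n _ <-].
apply: (@le_trans _ _
    (lpnorm p (fun i => if (i < n)%N then a i else 0) `^ p)); last first.
  by apply: lee_poweR (aC n); [exact: ltW|exact: lpnorm_ge0].
rewrite lpnormX//.
apply: le_trans (nneseries_lim_ge n _); last by move=> *; exact: poweR_ge0.
by rewrite big_mkord; apply: lee_sum => i _; rewrite ltn_ord.
Qed.

End Lpnorm.

(** * Real-valued norms over both scalar fields *)

Section ScalarNorm.
Context {R : realType} {k : scalar_kind}.
Local Notation K := (scalars R k).

(** A section of [rpart], by which real estimates pass to the order of the scalar field without a
    case analysis on [k]. *)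
Definition ofR : R -> K :=
  match k with
  | RealScalars => fun x : R => x
  | ComplexScalars => fun x : R => x%:C%C
  end.

Lemma ofRK x : rpart (ofR x) = x.
Proof. by rewrite /ofR /rpart; case: k. Qed.

Lemma rpartK (z : K) : 0 <= z -> ofR (rpart z) = z.
Proof.
rewrite /ofR /rpart; case: k z => //= -[a b].
by rewrite lecE/= => /andP[/eqP -> _].
Qed.

Lemma ofR_le x y : (ofR x <= ofR y) = (x <= y).
Proof. by rewrite /ofR; case: k => //=; rewrite lecR. Qed.

Lemma ofR_lt x y : (ofR x < ofR y) = (x < y).
Proof. by rewrite /ofR; case: k => //=; rewrite ltcR. Qed.

Lemma ofRD : {morph ofR : x y / x + y}.
Proof. by move=> x y; rewrite /ofR; case: k => //=; rewrite raddfD. Qed.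

Lemma ofRM : {morph ofR : x y / x * y}.
Proof. by move=> x y; rewrite /ofR; case: k => //=; rewrite rmorphM. Qed.

Lemma ofRV : {morph ofR : x / x^-1}.
Proof. by move=> x; rewrite /ofR; case: k => //=; rewrite fmorphV. Qed.

Lemma ofR0 : ofR 0 = 0.
Proof. by rewrite /ofR; case: k. Qed.

Lemma ofR1 : ofR 1 = 1.
Proof. by rewrite /ofR; case: k. Qed.

Lemma rpart_le (z w : K) : z <= w -> rpart z <= rpart w.
Proof.
by rewrite /rpart; case: k z w => //= -[a b] [c d]; rewrite lecE/= => /andP[].
Qed.

Lemma rpartD (z w : K) : rpart (z + w) = rpart z + rpart w.
Proof. by rewrite /rpart; case: k z w => //= -[a b] [c d]. Qed.

Lemma gtofR_ex (e : K) : 0 < e -> exists2 d : R, 0 < d & e = ofR d.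
Proof.
move=> e0; exists (rpart e); last by rewrite rpartK// ltW.
by rewrite -ofR_lt ofR0 rpartK// ltW.
Qed.

Section NormedModule.
Variable E : normedModType K.
Implicit Types x y : E.

Lemma ofR_rnorm x : ofR (rnorm x) = `|x|.
Proof. exact: rpartK. Qed.

Lemma rnorm_ge0 x : 0 <= rnorm x.
Proof. by rewrite -ofR_le ofR_rnorm ofR0. Qed.

Lemma ler_rnormD x y : rnorm (x + y) <= rnorm x + rnorm y.
Proof. by rewrite -rpartD; apply: rpart_le; exact: ler_normD. Qed.

Lemma rnorm0 : rnorm (0 : E) = 0.
Proof. by rewrite /rnorm normr0 -ofR0 ofRK. Qed.

Lemma rnormN x : rnorm (- x) = rnorm x.
Proof. by rewrite /rnorm normrN. Qed.

Lemma rnorm_eq0 x : rnorm x = 0 -> x = 0.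
Proof. by move=> x0; apply/normr0_eq0; rewrite -ofR_rnorm x0 ofR0. Qed.

Lemma rnormZ (c : K) x : rnorm (c *: x) = rpart `|c| * rnorm x.
Proof.
by rewrite /rnorm normrZ -{1}(rpartK (normr_ge0 c)) -{1}(rpartK (normr_ge0 x))
  -ofRM ofRK.
Qed.

Lemma norm_ofR (t : R) : `|ofR t| = ofR `|t|.
Proof.
rewrite /ofR; case: k => //=; rewrite normc_def/= expr0n/= addr0 sqrtr_sqr//.
Qed.

Lemma rnormZR (t : R) x : 0 <= t -> rnorm (ofR t *: x) = t * rnorm x.
Proof. by move=> t0; rewrite rnormZ norm_ofR ofRK ger0_norm. Qed.

End NormedModule.
End ScalarNorm.

(** * The Hahn-Banach theorem *)

Section HahnBanach.
Context {R : realType} {k : scalar_kind} {E : normedModType (scalars R k)}.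
Implicit Types (p q f : E -> R) (x y : E) (t c : R).

(** Only real scalars occur, so [E] counts as a real space. Homogeneity is an inequality, a form
    that passes to infima; applying it to [t^-1] recovers equality. *)
Definition sublinear p :=
  (forall x y, p (x + y) <= p x + p y) /\
  (forall t x, 0 <= t -> p (ofR t *: x) <= t * p x).

Lemma sublinearZ p t x : sublinear p -> 0 <= t -> p (ofR t *: x) = t * p x.
Proof.
move=> [pD pZ]; rewrite le_eqVlt => /predU1P[<-|t0].
  rewrite ofR0 scale0r mul0r; apply/eqP; rewrite eq_le; apply/andP; split.
    by have := pZ 0 0 (lexx _); rewrite scaler0 mul0r.
  by have := pD 0 0; rewrite addr0 lerDl.
apply/eqP; rewrite eq_le (pZ _ _ (ltW t0))//= -ler_pdivlMl//.
have := pZ t^-1 (ofR t *: x).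
rewrite scalerA -ofRM mulVf ?gt_eqF// ofR1 scale1r; apply.
by rewrite invr_ge0 ltW.
Qed.

Lemma sublinear0 p : sublinear p -> p 0 = 0.
Proof.
by move=> ps; have := sublinearZ 0 ps (lexx 0); rewrite scaler0 mul0r.
Qed.

Lemma sublinearN p x : sublinear p -> - p (- x) <= p x.
Proof.
by move=> ps; have := ps.1 x (- x); rewrite subrr sublinear0//; lra.
Qed.

(** Serves both [slide] and the infimum of a chain in Zorn's lemma. The minorant [m] keeps the
    infimum finite, and the index [l] may vary with the data, since no single [g i] need be
    sublinear. *)
Lemma inf_sublinear (I : Type) (A : set I) (g : I -> E -> R) (m : E -> R) :
  A !=set0 -> (forall i x, A i -> m x <= g i x) ->
  (forall i j x y, A i -> A j ->
    exists2 l, A l & g l (x + y) <= g i x + g j y) ->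
  (forall i t x, A i -> 0 <= t ->
    exists2 l, A l & g l (ofR t *: x) <= t * g i x) ->
  sublinear (fun x => inf [set g i x | i in A]).
Proof.
move=> [i0 Ai0] mg gD gZ.
have infP x i : A i -> inf [set g i x | i in A] <= g i x.
  move=> Ai; apply: ge_inf; last by exists i.
  by exists (m x) => _ [j Aj <-]; exact: mg.
have le_infP x c : (forall i, A i -> c <= g i x) ->
    c <= inf [set g i x | i in A].
  move=> cg; apply: lb_le_inf; first by exists (g i0 x), i0.
  by move=> _ [i Ai <-]; exact: cg.
split=> [x y|t x].
  rewrite -lerBlDr; apply: (le_infP) => i Ai.
  rewrite lerBlDr -lerBlDl; apply: (le_infP) => j Aj.
  have [l Al] := gD i j x y Ai Aj.
  by rewrite lerBlDl; apply: le_trans; exact: infP.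
rewrite le_eqVlt => /predU1P[<-|t0].
  have [l Al] := gZ _ _ x Ai0 (lexx 0); rewrite !mul0r.
  by apply: le_trans; exact: infP.
rewrite -ler_pdivrMl//; apply: (le_infP) => i Ai; rewrite ler_pdivrMl//.
by have [l Al] := gZ _ _ x Ai (ltW t0); apply: le_trans; exact: infP.
Qed.

(* Pushes [p] down in the direction of [y] until it becomes odd there. *)
Definition slide p y x : R :=
  inf [set p (x + ofR t *: y) - t * p y | t in [set t | 0 <= t]].

(** This is [p (t y) <= p (x + t y) + p (- x)]. The bound is independent of [t], so the infimum in
    [slide] is finite. *)
Lemma slide_lb p y x t : sublinear p -> 0 <= t ->
  - p (- x) <= p (x + ofR t *: y) - t * p y.
Proof.
move=> ps t0; rewrite -sublinearZ//.
have := ps.1 (x + ofR t *: y) (- x).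
by rewrite addrAC subrr add0r; lra.
Qed.

Lemma slide_le_term p y x t : sublinear p -> 0 <= t ->
  slide p y x <= p (x + ofR t *: y) - t * p y.
Proof.
move=> ps t0; apply: ge_inf; last by exists t.
by exists (- p (- x)) => _ [c c0 <-]; exact: slide_lb.
Qed.

Lemma slide_sublinear p y : sublinear p -> sublinear (slide p y).
Proof.
move=> ps; apply: (@inf_sublinear _ _ _ (fun x => - p (- x))).
- by exists 0 => /=.
- by move=> t x /= t0; exact: slide_lb.
- move=> s t x z /= s0 t0; exists (s + t); first exact: addr_ge0.
  rewrite ofRD scalerDl addrACA.
  have := ps.1 (x + ofR s *: y) (z + ofR t *: y); lra.
- move=> t c x /= t0 c0; exists (c * t); first exact: mulr_ge0.
  by rewrite ofRM -scalerA -scalerDr sublinearZ// mulrBr mulrA.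
Qed.

Lemma slide_le p y x : sublinear p -> slide p y x <= p x.
Proof.
move=> ps; apply: le_trans (slide_le_term _ _ ps (lexx 0)) _.
by rewrite ofR0 scale0r addr0 mul0r subr0.
Qed.

Definition real_linear f :=
  (forall x y, f (x + y) = f x + f y) /\ (forall t x, f (ofR t *: x) = t * f x).

(* Applying Zorn's lemma to sublinear functionals instead of partial linear
   extensions: a minimal one is fixed by every [slide], hence additive. *)
Lemma minimal_sublinear_linear q : sublinear q ->
  (forall q', sublinear q' -> (forall x, q' x <= q x) -> q' = q) ->
  real_linear q.
Proof.
move=> qs qmin.
have qD x y : q (x + y) = q x + q y.
  apply/eqP; rewrite eq_le qs.1/=.
  (* By minimality [q x = slide q y x], which at [t = 1] is at most [q (x + y) - q y]: the reverse
     of subadditivity. *)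
  have <- : slide q y x = q x.
    rewrite (qmin (slide q y))//; first exact: slide_sublinear.
    by move=> z; exact: slide_le.
  have := slide_le_term y x qs ler01.
  by rewrite ofR1 scale1r mul1r lerBrDr.
split=> // t x; have [t0|t0] := leP 0 t; first exact: sublinearZ.
have := qD (ofR t *: x) (ofR (- t) *: x).
rewrite -scalerDl -ofRD subrr ofR0 scale0r sublinear0// (@sublinearZ q (- t))//.
  by lra.
by rewrite oppr_ge0 ltW.
Qed.

Lemma sublinear_dominates_linear p : sublinear p ->
  exists2 f, real_linear f & forall x, f x <= p x.
Proof.
move=> ps; pose P q := sublinear q /\ forall x, q x <= p x.
pose T := {q : E -> R | P q}.
have [|||A Atot|[q [qs qp]] qmin] :=
  (* The order is reversed, so a maximal element is a minimal sublinear functional. *)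
  @Zorn T (fun u v : T => `[< forall x, sval v x <= sval u x >]).
- by move=> q; apply/asboolP.
- move=> q1 q2 q3 /asboolP q12 /asboolP q23; apply/asboolP => x.
  exact: le_trans (q23 x) (q12 x).
- move=> [q1 Pq1] [q2 Pq2] /asboolP/= q12 /asboolP/= q21.
  have q1E : q1 = q2 by apply/funext => x; apply/eqP; rewrite eq_le q12 q21.
  by subst q2; congr exist; exact: Prop_irrelevance.
- have [[q0 Aq0]|A0] := pselect (A !=set0); last first.
    exists (exist _ p (conj ps (fun=> lexx _))) => q Aq.
    by exfalso; apply: A0; exists q.
  (* All sublinear functionals below [p] share this minorant, so the pointwise infimum of a chain is
     finite. *)
  have lb (q : T) x : A q -> - p (- x) <= sval q x.
    move=> _; case: q => q [/= qs qp].
    by rewrite (le_trans _ (sublinearN x qs))// lerN2.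
  pose q x := inf [set sval q x | q in A].
  have qle (q' : T) x : A q' -> q x <= sval q' x.
    move=> Aq'; apply: ge_inf; last by exists q'.
    by exists (- p (- x)) => _ [q'' Aq'' <-]; exact: lb.
  have Pq : P q.
    split=> [|x]; last by apply: le_trans (qle q0 x Aq0) _; case: (q0) => q1 [].
    apply: (@inf_sublinear _ _ _ (fun x => - p (- x))).
    + by exists q0.
    + by move=> q' x; exact: lb.
    + move=> q1 q2 x y A1 A2.
      have [/asboolP q12|/asboolP q21] := Atot _ _ A1 A2.
        exists q2 => //; apply: le_trans ((svalP q2).1.1 _ _) _.
        by rewrite lerD2r.
      exists q1 => //; apply: le_trans ((svalP q1).1.1 _ _) _.
      by rewrite lerD2l.
    + by move=> q1 t x A1 t0; exists q1 => //; exact: (svalP q1).1.2.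
  by exists (exist _ q Pq) => q' Aq'; apply/asboolP => x; exact: qle.
exists q => //; apply: minimal_sublinear_linear => // q' q's q'q.
have Pq' : P q' by split=> // x; exact: le_trans (q'q x) (qp x).
by apply: (congr1 sval (qmin (exist _ q' Pq') _)); apply/asboolP.
Qed.

Lemma rnorm_sublinear : sublinear (@rnorm R k E).
Proof.
split=> [x y|t x t0]; first exact: ler_rnormD.
by rewrite rnormZR.
Qed.

(** Rather than extending a functional from the line through [x0], the norm is first slid along
    [x0]. With [t = 1] the slid norm at [- x0] is at most [- rnorm x0], which forces
    [f x0 >= rnorm x0] for every linear [f] below it. *)
Lemma hahn_banach_real x0 : exists2 f, real_linear f &
  (forall x, f x <= rnorm x) /\ rnorm x0 <= f x0.
Proof.
have ns := rnorm_sublinear.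
have [f fl fle] := sublinear_dominates_linear (slide_sublinear x0 ns).
exists f => //; split=> [x|]; first exact: le_trans (fle x) (slide_le _ _ ns).
have fN : f (- x0) = - f x0.
  by have := fl.1 x0 (- x0); rewrite subrr -(scaler0 _ (ofR 0)) fl.2; lra.
rewrite -lerN2 -fN; apply: le_trans (fle _) _.
apply: le_trans (slide_le_term _ _ ns ler01) _.
by rewrite ofR1 scale1r addNr rnorm0 mul1r sub0r.
Qed.

End HahnBanach.

(** * Bounded linear operators and their norms *)

Section ContinuousLinear.
Context {R : realType} {k : scalar_kind}.
Local Notation K := (scalars R k).
Local Notation banach := (completeNormedModType K).

Lemma clinear_bound (U V : banach) (u : clinear U V) :
  exists2 M : R, 0 <= M & forall x, rnorm (u x) <= M * rnorm x.
Proof.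
have := continuous_linear_bounded 0 (@clinear_continuous _ _ _ _ u 0).
move=> /linear_boundedP/pinfty_ex_gt0[M M0 Mu].
have [r r0 Mr] := gtofR_ex M0; exists r; first exact: ltW.
by move=> x; rewrite -(@ofR_le R k) ofRM !ofR_rnorm -Mr.
Qed.

Lemma bounded_clinear (U V : banach) (f : U -> V) (M : R) :
  linear f -> (forall x, rnorm (f x) <= M * rnorm x) ->
  exists u : clinear U V, u =1 f.
Proof.
move=> fl fM.
pose F : {linear U -> V} := HB.pack f (GRing.isLinear.Build K U V *:%R f fl).
have Fc : continuous F.
  apply/bounded_linear_continuous/linear_boundedP.
  near=> r => x.
  apply: (@le_trans _ _ (ofR M * `|x|)).
    by rewrite -!ofR_rnorm -ofRM ofR_le fM.
  apply: ler_wpM2r => //; near: r; apply: nbhs_pinfty_ge.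
  by rewrite realE -ofR0 !ofR_le -realE num_real.
by exists (CLinear Fc).
Unshelve. all: by end_near. Qed.

Local Open Scope ereal_scope.

Lemma opnorm_ge0 (U V : banach) (u : clinear U V) : 0 <= opnorm u.
Proof.
apply: ereal_sup_ubound; exists 0%R; first by rewrite /= rnorm0.
by rewrite linear0 rnorm0.
Qed.

Lemma opnorm_leP (U V : banach) (u : clinear U V) (M : R) : (0 <= M)%R ->
  opnorm u <= M%:E <-> forall x, (rnorm (u x) <= M * rnorm x)%R.
Proof.
move=> M0; split=> [uM x|uM]; last first.
  apply: ge_ereal_sup => _ [x /= x1 <-]; rewrite lee_fin.
  by rewrite (le_trans (uM x))// ler_piMr.
have [x0|xn0] := eqVneq (rnorm x) 0%R.
  by rewrite (rnorm_eq0 x0) linear0 !rnorm0 mulr0.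
have x0 : (0 < rnorm x)%R by rewrite lt0r xn0 rnorm_ge0.
rewrite -ler_pdivrMr// mulrC -rnormZR ?invr_ge0 ?rnorm_ge0// -linearZ.
rewrite -lee_fin; apply: le_trans uM; apply: ereal_sup_ubound.
exists (ofR (rnorm x)^-1 *: x)%R => //=.
by rewrite rnormZR ?invr_ge0 ?rnorm_ge0// mulVf.
Qed.

Lemma opnorm_lty (U V : banach) (u : clinear U V) : opnorm u < +oo.
Proof.
have [M M0 uM] := clinear_bound u.
by apply: le_lt_trans (ltry M); apply/opnorm_leP.
Qed.

Lemma opnorm_fin_num (U V : banach) (u : clinear U V) :
  opnorm u \is a fin_num.
Proof. by rewrite ge0_fin_numE ?opnorm_ge0 ?opnorm_lty. Qed.

Lemma rnorm_le_opnorm (U V : banach) (u : clinear U V) x :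
  (rnorm (u x))%:E <= opnorm u * (rnorm x)%:E.
Proof.
have ufin := opnorm_fin_num u.
rewrite -(fineK ufin) -EFinM lee_fin.
by apply: (opnorm_leP u _).1; rewrite ?fine_ge0 ?opnorm_ge0// fineK.
Qed.

(** Only the norms of the values are recorded: mixed norms depend on the functionals through these
    alone. *)
Lemma clinear_scale (U V : banach) (u : clinear U V) (a : R) : (0 <= a)%R ->
  exists v : clinear U V, (forall x, rnorm (v x) = a * rnorm (u x))%R /\
    opnorm v <= a%:E * opnorm u.
Proof.
move=> a0; have [M M0 uM] := clinear_bound u.
have [| |v vE] := @bounded_clinear U V (fun x => ofR a *: u x)%R (a * M)%R.
- by move=> c x y; rewrite linearP scalerDr !scalerA mulrC.
- by move=> x; rewrite rnormZR// -mulrA ler_wpM2l.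
have vE' x : (rnorm (v x) = a * rnorm (u x))%R by rewrite vE rnormZR.
exists v; split=> //.
have ufin := opnorm_fin_num u.
rewrite -(fineK ufin) -EFinM; apply/opnorm_leP.
  by rewrite mulr_ge0 ?fine_ge0 ?opnorm_ge0.
move=> x; rewrite vE' -mulrA ler_wpM2l// -lee_fin EFinM fineK//.
exact: rnorm_le_opnorm.
Qed.

Lemma clinear_comp (U V W : banach) (u : clinear U V) (v : clinear V W) :
  exists w : clinear U W, (forall x, w x = v (u x)) /\
    opnorm w <= opnorm u * opnorm v.
Proof.
have [M M0 uM] := clinear_bound u; have [N N0 vN] := clinear_bound v.
have [| |w wE] := @bounded_clinear U W (fun x => v (u x)) (N * M)%R.
- by move=> c x y; rewrite !linearP.
- by move=> x; rewrite (le_trans (vN _))// -mulrA ler_wpM2l.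
exists w; split=> //.
have ufin := opnorm_fin_num u.
have vfin := opnorm_fin_num v.
rewrite muleC -(fineK ufin) -(fineK vfin) -EFinM; apply/opnorm_leP.
  by rewrite mulr_ge0 ?fine_ge0 ?opnorm_ge0.
move=> x; rewrite wE -lee_fin (le_trans (rnorm_le_opnorm _ _))//.
rewrite -{1}(fineK vfin) -EFinM lee_fin -mulrA.
rewrite ler_wpM2l ?fine_ge0 ?opnorm_ge0//.
by rewrite -lee_fin EFinM fineK// rnorm_le_opnorm.
Qed.

End ContinuousLinear.

(** * Norming functionals over the real and complex fields *)

Section HahnBanachDual.
Context {R : realType}.

(** The classical complexification [g x = f x - i f (i x)] is complex-linear with real part [f]. *)
Lemma hahn_banach_complex (E : completeNormedModType (scalars R ComplexScalars))
    (f : E -> R) : real_linear f -> (forall x, f x <= rnorm x) ->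
  exists phi : dual E, (forall x, rnorm (phi x) <= rnorm x) /\
    forall x, f x <= rnorm (phi x).
Proof.
move=> [fD fZ] fle.
pose g (x : E) : kspace R ComplexScalars := (f x -i* f (('i%C : R[i]) *: x))%C.
have fR (a b : R) x :
    f ((a +i* b)%C *: x) = a * f x + b * f (('i%C : R[i]) *: x).
  rewrite -!fZ -fD scalerA -scalerDl; congr (f (_ *: _)).
  by rewrite /ofR; simpc.
have gl : linear g.
  move=> [a b] x y; rewrite /g scalerDr !fD scalerA.
  have -> : 'i%C * (a +i* b)%C = (- b +i* a)%C by simpc.
  rewrite (fR a b x) (fR (- b) a x).
  move: (f x) (f y) (f ('i%C *: x)) (f ('i%C *: y)) => p q r s.
  change ((a * p + b * r + q) -i* (- b * p + a * r + s) =
          (a +i* b) * (p -i* r) + (q -i* s))%C.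
  by congr (_ +i* _)%C; ring.
have gle x : rnorm (g x) <= 1 * rnorm x.
  have [gx0|gx0] := eqVneq (g x) 0; first by rewrite gx0 rnorm0 mul1r rnorm_ge0.
  pose z : R[i] := g x.
  (* A unimodular rotation making [g (c *: x)] real and nonnegative: it then equals [f (c *: x)],
     which the norm of [x] bounds. *)
  pose c : R[i] := `|z| / z.
  have c1 : `|c| = 1 by rewrite normrM normfV normr_id mulfV// normr_eq0.
  have gcx : g (c *: x) = `|z|.
    have := gl c x 0; rewrite addr0 => ->.
    have -> : g 0 = 0.
      by rewrite /g scaler0 -(scaler0 _ (ofR 0)) fZ mul0r oppr0.
    by rewrite addr0; exact: divfK.
  have -> : rnorm (g x) = f (c *: x).
    by have := congr1 (@complex.Re R) gcx => /= ->.
  apply: le_trans (fle _) _; rewrite rnormZ.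
  rewrite ler_wpM2r ?rnorm_ge0// -[leRHS](@ofRK R ComplexScalars) ofR1.
  by rewrite rpart_le// c1.
have [phi phiE] := bounded_clinear gl gle.
exists phi; split=> x; rewrite phiE; first by rewrite -[leRHS]mul1r.
have /(@rpart_le R ComplexScalars) := normc_ge_Re (g x).
by apply: le_trans; rewrite /= ler_norm.
Qed.


Lemma hahn_banach k (E : completeNormedModType (scalars R k)) (x : E) :
  exists2 phi : dual E, (opnorm phi <= 1)%E & rnorm x <= rnorm (phi x).
Proof.
have [f fl [fle fx]] := hahn_banach_real x.
suff [phi [phile phige]] : exists phi : dual E,
    (forall x, rnorm (phi x) <= rnorm x) /\ forall x, f x <= rnorm (phi x).
  exists phi; last exact: le_trans fx (phige x).
  by apply/opnorm_leP => // y; rewrite mul1r.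
case: k E x f fl fle {fx} => E x f fl fle; last exact: hahn_banach_complex.
(* Over the reals [f] itself is the functional; oddness turns its one-sided bound into a two-sided
   one. *)
have fN y : f (- y) = - f y.
  have := fl.1 y (- y); have := fl.2 0 y.
  by rewrite /ofR scale0r subrr mul0r => ->; lra.
have [| |phi phiE] :=
  @bounded_clinear R RealScalars E (kspace R RealScalars) f 1.
- by move=> c y z; rewrite fl.1; congr (_ + _); exact: fl.2.
- move=> y; rewrite mul1r /rnorm/=; rewrite ler_norml fle andbT.
  by rewrite lerNl -fN (le_trans (fle _))// rnormN.
exists phi; split=> y; rewrite phiE.
- rewrite /rnorm/= ler_norml fle andbT.
  by rewrite lerNl -fN (le_trans (fle _))// rnormN.
- by rewrite /rnorm /= ler_norm.
Qed.
End HahnBanachDual.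

(** * Banach spaces of sequences from extended norms *)

Section SeqNormed.
Context {R : realType} {k : scalar_kind}.
Local Notation K := (scalars R k).
Local Notation banach := (completeNormedModType K).
Local Open Scope ereal_scope.

Definition delta_seq (E : banach) (j : nat) (v : E) : nat -> E :=
  fun i => if i == j then v else 0%R.

(** Membership will mean finite norm. [sn_ge_term] gives the embedding into l_infty and the
    continuity of coordinates, [sn_delta] puts finite sequences inside and, with [sn_ge_term],
    normalises the unit sequences; [sn_truncate] gives finite determination and, with the rest,
    completeness. *)
Record seq_normed (E : banach) : Type := SeqNormed {
  sn :> (nat -> E) -> \bar R;
  snD : forall x y, sn (x + y)%R <= sn x + sn y;
  snZ : forall (c : K) x, sn x < +oo -> sn (c *: x)%R <= (rpart `|c|)%:E * sn x;
  sn_ge_term : forall x j, (rnorm (x j))%:E <= sn x;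
  sn_truncate : forall x, sn x = ereal_sup (range (sn \o truncate x));
  sn_delta : forall j v, sn (delta_seq j v) <= (rnorm v)%:E
}.

Variable (E : banach) (N : seq_normed E).

Lemma sn_ge0 x : 0 <= N x.
Proof. by apply: le_trans (sn_ge_term N x 0); rewrite lee_fin rnorm_ge0. Qed.

Definition sn_finite : {pred nat -> E} := [pred x | N x < +oo].

Lemma sn_fin_num x : x \in sn_finite -> N x \is a fin_num.
Proof. by rewrite ge0_fin_numE ?sn_ge0. Qed.

Lemma sn0 : N 0%R = 0.
Proof.
have N0 : N 0%R < +oo.
  rewrite -(_ : delta_seq 0%N (0%R : E) = 0%R).
    exact: le_lt_trans (sn_delta _ _ _) (ltry _).
  by apply/funext => i; rewrite /delta_seq; case: ifP.
apply/eqP; rewrite eq_le sn_ge0 andbT.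
by have := snZ 0%R N0; rewrite scale0r normr0 -ofR0 ofRK mul0e.
Qed.

Lemma snZE (c : K) x : N x < +oo -> N (c *: x)%R = (rpart `|c|)%:E * N x.
Proof.
move=> Nx; apply/eqP; rewrite eq_le snZ//=.
have [->|c0] := eqVneq c 0%R.
  by rewrite normr0 -ofR0 ofRK mul0e sn_ge0.
have cx : N (c *: x)%R < +oo.
  apply: le_lt_trans (snZ _ Nx) _.
  by rewrite -(fineK (sn_fin_num Nx)) -EFinM ltry.
have := snZ c^-1 cx.
rewrite scalerA mulVf// scale1r.
have rc : (0 < rpart `|c|)%R by rewrite -(@ofR_lt R k) ofR0 rpartK ?normr_gt0.
rewrite -(fineK (sn_fin_num Nx)) -(fineK (sn_fin_num cx)) -!EFinM !lee_fin.
rewrite normfV.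
rewrite -{1}(rpartK (normr_ge0 c)).
rewrite -ofRV ofRK => h.
by rewrite -ler_pdivlMl.
Qed.

Lemma sn_finite_submod : submod_closed sn_finite.
Proof.
split=> [|c x y xfin yfin]; first by rewrite inE/= sn0.
rewrite inE/=; apply: le_lt_trans (snD N _ _) _.
apply: lte_add_pinfty => //.
apply: le_lt_trans (snZ _ xfin) _.
by rewrite -(fineK (sn_fin_num xfin)) -EFinM ltry.
Qed.

HB.instance Definition _ :=
  GRing.isSubmodClosed.Build K (nat -> E) sn_finite sn_finite_submod.

Record snseq : Type := SNSeq {
  snseq_val : nat -> E;
  snseq_finite : snseq_val \in sn_finite
}.

HB.instance Definition _ := [isSub for snseq_val].
HB.instance Definition _ := [Choice of snseq by <:].
HB.instance Definition _ := [SubChoice_isSubLmodule of snseq by <:].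

Definition snseq_norm (x : snseq) : K := ofR (fine (N (snseq_val x))).

Lemma ler_snseq_normD x y :
  (snseq_norm (x + y) <= snseq_norm x + snseq_norm y)%R.
Proof.
rewrite -ofRD ofR_le -lee_fin EFinD !fineK ?snD//;
  exact: sn_fin_num (snseq_finite _).
Qed.

Lemma snseq_normZ (c : K) x : snseq_norm (c *: x)%R = (`|c| * snseq_norm x)%R.
Proof.
rewrite -(rpartK (normr_ge0 c)) -ofRM; congr ofR.
rewrite snZE ?fineM//; last exact: snseq_finite.
exact: sn_fin_num (snseq_finite _).
Qed.

Lemma snseq_norm_eq0 x : snseq_norm x = 0%R -> x = 0%R.
Proof.
rewrite -ofR0 => /(congr1 (@rpart R k)); rewrite !ofRK => x0.
apply/val_inj/funext => j; apply: rnorm_eq0; apply/eqP.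
rewrite eq_le rnorm_ge0 andbT -lee_fin -x0 fineK; first exact: sn_ge_term.
exact: sn_fin_num (snseq_finite _).
Qed.

HB.instance Definition _ := Lmodule_isNormed.Build K snseq
  ler_snseq_normD snseq_normZ snseq_norm_eq0.

Lemma rnorm_snseq (x : snseq) : (rnorm x)%:E = N (snseq_val x).
Proof. by rewrite /rnorm ofRK fineK//; exact: sn_fin_num (snseq_finite _). Qed.

Lemma sn_truncate_le x n : N (truncate x n) <= \sum_(j < n) (rnorm (x j))%:E.
Proof.
elim: n => [|n IHn].
  rewrite big_ord0 (_ : truncate x 0 = 0%R) ?sn0//.
rewrite big_ord_recr /=.
rewrite -(_ : truncate x n + delta_seq n (x n) = truncate x n.+1)%R.
  by apply: le_trans (snD N _ _) (leeD IHn (sn_delta _ _ _)).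
apply/funext => j.
change (truncate x n j + delta_seq n (x n) j = truncate x n.+1 j)%R.
rewrite /truncate /delta_seq ltnS.
by case: (ltngtP j n) => [||->] /=; rewrite ?addr0 ?add0r.
Qed.

(** On the first [n] coordinates, coordinatewise closeness is closeness in norm by [sn_truncate_le],
    so each truncation of [x] inherits the bound up to an arbitrary error. *)
Lemma sn_le_closed x (C : R) :
  (forall n (e : R), (0 < e)%R -> exists2 y, N y <= C%:E &
     forall j, (j < n)%N -> (rnorm (x j - y j) <= e)%R) ->
  N x <= C%:E.
Proof.
move=> xy; rewrite sn_truncate; apply: ge_ereal_sup => _ [n _ <-] /=.
apply/lee_addgt0Pr => e e0.
(* The [n] coordinate errors add up to at most [e]; the successor covers [n = 0]. *)
have en0 : (0 < e / n.+1%:R)%R by rewrite divr_gt0.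
have [y Ny yx] := xy n _ en0.
rewrite (_ : truncate x n = truncate y n + truncate (x - y) n)%R; last first.
  apply/funext => j.
  change (truncate x n j = truncate y n j + truncate (x - y) n j)%R.
  rewrite /truncate; case: ifP => _; last by rewrite addr0.
  by change (x j = y j + (x j - y j))%R; rewrite addrC subrK.
apply: le_trans (snD N _ _) _; apply: leeD.
  apply: le_trans Ny; rewrite [leRHS]sn_truncate; apply: ereal_sup_ubound.
  by exists n.
apply: le_trans (sn_truncate_le _ _) _.
rewrite sumEFin lee_fin.
apply: (@le_trans _ _ (\sum_(j < n) (e / n.+1%:R))%R).
  by apply: ler_sum => j _; apply: yx.
rewrite sumr_const card_ord -(mulr_natr (e / n.+1%:R)%R) -mulrA.
rewrite ler_piMr ?(ltW e0)//.
by rewrite mulrC ler_pdivrMr// mul1r ler_nat.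
Qed.

Lemma snseq_complete (F : set_system snseq) :
  ProperFilter F -> cauchy F -> cvg F.
Proof.
move=> FF Fcauchy.
have Fc (e : R) : (0 < e)%R ->
    exists z : snseq, \forall w \near F, (`|z - w| < ofR e)%R.
  move=> e0; have e0' : (0 < ofR e :> K)%R by rewrite -ofR0 ofR_lt.
  have /cauchyP/(_ _ e0')[z Fz] := Fcauchy.
  by exists z; apply: filterS Fz => w; rewrite -ball_normE.
have coord_le (z w : snseq) j :
    (rnorm (snseq_val z j - snseq_val w j) <= rnorm (z - w)%R)%R.
  rewrite -lee_fin rnorm_snseq.
  exact: (sn_ge_term N (snseq_val z - snseq_val w)%R j).
have coord j : exists a : E, (fun w : snseq => snseq_val w j) @ F --> a.
  apply/cvg_ex; apply: cauchy_cvg; apply/cauchyP => e e0.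
  have [d d0 eE] := gtofR_ex e0; have [z Fz] := Fc _ d0.
  exists (snseq_val z j).
  change (F ((fun w : snseq => snseq_val w j) @^-1` ball (snseq_val z j) e)).
  apply: filterS Fz => w zw; rewrite -ball_normE /ball_/= eE.
  by apply: le_lt_trans zw; rewrite -!ofR_rnorm ofR_le.
have [l lF] := choice coord.
(* The bound on [w - z] passes to the coordinatewise limit [l - z] by [sn_le_closed]. *)
have Nl (e : R) (z : snseq) : (\forall w \near F, (`|z - w| < ofR e)%R) ->
    N (l - snseq_val z)%R <= e%:E.
  move=> Fz; apply: sn_le_closed => n d d0.
  have d0' : (0 < ofR d :> K)%R by rewrite -ofR0 ofR_lt.
  near F => w.
  exists (snseq_val w - snseq_val z)%R.
    rewrite (_ : N _ = (rnorm (w - z)%R)%:E); last by rewrite rnorm_snseq.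
    by rewrite lee_fin ltW// -(@ofR_lt R k) ofR_rnorm distrC; near: w.
  move=> j jn.
  change (rnorm ((l j - snseq_val z j) -
    (snseq_val w j - snseq_val z j)) <= d)%R.
  rewrite opprB addrA subrK -(@ofR_le R k) ofR_rnorm ltW//.
  (* One [w] must be close in all [n] coordinates at once; ranging over a finite type allows the
     filter conditions to be intersected. *)
  rewrite -[j]/(nat_of_ord (Ordinal jn)); move: (Ordinal jn).
  near: w; apply: filter_forall => i.
  by have /cvgrPdist_lt/(_ _ d0') := lF i.
(* A single ball puts [l] in the space, through [l = (l - z1) + z1]. *)
have [z1 Fz1] := Fc 1%R ltr01.
have lfin : l \in sn_finite.
  rewrite inE /= -(subrK (snseq_val z1) l).
  apply: le_lt_trans (snD N _ _) _; apply: lte_add_pinfty.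
    exact: le_lt_trans (Nl _ _ Fz1) (ltry _).
  exact: snseq_finite.
apply/cvg_ex; exists (SNSeq lfin); apply/cvgrPdist_le => e e0.
have [d d0 ->] := gtofR_ex e0.
have [z Fz] := Fc _ (divr_gt0 d0 (ltr0n _ 2)).
apply: filterS (Fz) => w zw.
rewrite (le_trans (ler_distD z _ _))// (splitr d) ofRD lerD ?(ltW zw)//.
rewrite -ofR_rnorm ofR_le -lee_fin rnorm_snseq.
exact: Nl Fz.
Unshelve. all: by end_near. Qed.

HB.instance Definition _ := Uniform_isComplete.Build snseq snseq_complete.

Definition snseq_banach : banach := snseq.

End SeqNormed.

(** * Sequence classes from families of extended norms *)

Section ClassOfSeqNorms.
Context {R : realType} {k : scalar_kind}.
Local Notation K := (scalars R k).
Local Notation banach := (completeNormedModType K).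
Local Open Scope ereal_scope.
Variable N : forall E : banach, seq_normed E.

Section Values.
Variable E : banach.

Lemma snseq_val_is_linear : linear (@snseq_val R k E (N E)).
Proof. by []. Qed.

HB.instance Definition _ := GRing.isLinear.Build K (snseq (N E)) (nat -> E) *:%R
  (@snseq_val R k E (N E)) snseq_val_is_linear.

Lemma range_snseq_val x : range (@snseq_val R k E (N E)) x <-> N E x < +oo.
Proof.
split=> [[v _ <-]|xfin]; first exact: (snseq_finite v).
by exists (@SNSeq _ _ _ (N E) x xfin).
Qed.

(** The fibre over [x] is one point when [N E x] is finite; otherwise it is empty, with infimum
    [+oo]. *)
Lemma seq_norm_snseq x : seq_norm (@snseq_val R k E (N E)) x = N E x.
Proof.
have [xfin|xinf] := pselect (N E x < +oo).
  pose v := @SNSeq _ _ _ (N E) x xfin.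
  rewrite /seq_norm (_ : [set w | _ w = x] = [set v]).
    by rewrite image_set1 ereal_inf1 rnorm_snseq.
  by apply/seteqP; split=> [w /= wx|w ->]//; exact/val_inj.
rewrite /seq_norm (_ : [set w | _ w = x] = set0).
  rewrite image_set0 ereal_inf0; apply/esym/eqP.
  by rewrite -leye_eq leNgt; apply/negP.
apply/seteqP; split=> [w /= wx|w]//; apply: xinf; rewrite -wx.
exact: (snseq_finite w).
Qed.

Lemma c00_snseq : c00 E `<=` range (@snseq_val R k E (N E)).
Proof.
move=> x [n xn]; apply/range_snseq_val.
rewrite (_ : x = truncate x n).
  by apply: le_lt_trans (sn_truncate_le _ _ _) _; rewrite sumEFin ltry.
by apply/funext => j; rewrite /truncate; case: ltnP => // /xn.
Qed.

Lemma linfty_norm_snseq (v : snseq (N E)) :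
  linfty_norm (snseq_val v) <= (rnorm v)%:E.
Proof.
apply: ge_ereal_sup => _ [j _ <-]; rewrite rnorm_snseq; exact: sn_ge_term.
Qed.

Lemma linfty_snseq : range (@snseq_val R k E (N E)) `<=` linfty E.
Proof.
by move=> _ [v _ <-]; apply: le_lt_trans (linfty_norm_snseq v) (ltry _).
Qed.

End Values.

Lemma sn_unit_seq j : N (kspace R k) (unit_seq R k j) = 1.
Proof.
have n1 : rnorm (1%R : kspace R k) = 1%R.
  by rewrite /rnorm normr1 -(@ofR1 R k) ofRK.
rewrite -n1; apply/eqP; rewrite eq_le; apply/andP; split.
  rewrite (_ : unit_seq R k j = delta_seq j (1%R : kspace R k)) ?sn_delta//.
  by apply/funext => i; rewrite /unit_seq /delta_seq; case: eqP.
have := sn_ge_term (N (kspace R k)) (unit_seq R k j) j.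
by rewrite {1}/unit_seq eqxx.
Qed.

Definition class_of_sn : sequence_class R k :=
  @SequenceClass R k (fun E => snseq_banach (N E))
    (fun E => @snseq_val R k E (N E) :
       {linear snseq_banach (N E) -> (nat -> E)})
    (fun E => val_inj) c00_snseq linfty_snseq linfty_norm_snseq
    (fun j => etrans (seq_norm_snseq _) (sn_unit_seq j)).

Lemma class_of_sn_finitely_determined : finitely_determined class_of_sn.
Proof.
move=> E x /=.
have -> : seq_norm (@snseq_val R k E (N E)) = N E.
  by apply/funext => y; exact: seq_norm_snseq.
by rewrite -sn_truncate; split=> //; exact: range_snseq_val.
Qed.

Lemma class_of_sn_linearly_stable :
  (forall (U V : banach) (u : clinear U V) (x : nat -> U), N U x < +oo ->
    N V (u \o x) <= opnorm u * N U x) -> linearly_stable class_of_sn.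
Proof.
move=> Nu U V u.
have ufin := opnorm_fin_num u.
have fin (v : snseq (N U)) : u \o snseq_val v \in sn_finite (N V).
  rewrite inE/=; apply: le_lt_trans (Nu _ _ _ _ (snseq_finite v)) _.
  by rewrite -(fineK ufin) -rnorm_snseq -EFinM ltry.
pose f (v : snseq_banach (N U)) : snseq_banach (N V) := SNSeq (fin v).
have fl : linear f.
  move=> c v w; apply/val_inj/funext => j /=.
  exact: (linearP u c (snseq_val v j) (snseq_val w j)).
have fM v : (rnorm (f v) <= fine (opnorm u) * rnorm v)%R.
  rewrite -lee_fin EFinM fineK// !rnorm_snseq.
  by apply: Nu; exact: snseq_finite.
have [uhat uhatE] := bounded_clinear fl fM.
exists uhat; split=> [v j|]; first by rewrite uhatE.
apply/eqP; rewrite eq_le; apply/andP; split.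
  rewrite -(fineK ufin); apply/opnorm_leP.
    by rewrite fine_ge0 ?opnorm_ge0.
  by move=> v; rewrite uhatE.
have hfin := opnorm_fin_num uhat.
rewrite -(fineK hfin); apply/opnorm_leP; first by rewrite fine_ge0 ?opnorm_ge0.
move=> x.
(* For the lower bound, [uhat] is tested on [x] placed at coordinate 0: [sn_delta] bounds the norm
   of the input and [sn_ge_term] reads [u x] off the output. *)
have dfin : delta_seq 0%N x \in sn_finite (N U).
  by rewrite inE/=; exact: le_lt_trans (sn_delta _ _ _) (ltry _).
pose d : snseq_banach (N U) := SNSeq dfin.
rewrite -lee_fin EFinM fineK//.
apply: (@le_trans _ _ (rnorm (uhat d))%:E).
  rewrite uhatE rnorm_snseq.
  exact: (sn_ge_term (N V) (u \o delta_seq 0%N x) 0).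
apply: le_trans (rnorm_le_opnorm _ _) _.
apply: lee_wpmul2l; first exact: opnorm_ge0.
by rewrite rnorm_snseq; exact: sn_delta.
Qed.

End ClassOfSeqNorms.

(** * The anisotropic spaces *)

Section EllA.
Context {R : realType} {k : scalar_kind}.
Local Notation K := (scalars R k).
Local Notation banach := (completeNormedModType K).
Local Open Scope ereal_scope.
Variables s q r : R.
Hypotheses (s_ge1 : (1 <= s)%R) (q_ge1 : (1 <= q)%R) (r_ge1 : (1 <= r)%R).
Hypothesis r_le_s : (r <= s)%R.

Let s0 : (0 < s)%R. Proof. exact: lt_le_trans s_ge1. Qed.
Let q0 : (0 < q)%R. Proof. exact: lt_le_trans q_ge1. Qed.
Let r0 : (0 < r)%R. Proof. exact: lt_le_trans r_ge1. Qed.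

Section OneSpace.
Variable E : banach.
Implicit Types (phi psi : nat -> dual E) (x y : nat -> E).

Definition mixed_norm phi x : \bar R :=
  lpnorm q (fun j => lpnorm s (fun i => (rnorm (phi i (x j)))%:E)).

Lemma ellA_sumE phi x : ellA_sum s q phi x `^ q^-1 = mixed_norm phi x.
Proof.
rewrite /ellA_sum /mixed_norm /lpnorm; congr (_ `^ _).
by apply: eq_eseriesr => j _; rewrite mulrC poweRrM.
Qed.

Lemma ellA_normE x : ellA_norm s q r x =
  ereal_sup [set mixed_norm phi x |
    phi in [set phi | lpnorm r (fun i => opnorm (phi i)) <= 1]].
Proof.
rewrite /ellA_norm; congr ereal_sup.
by apply: eq_imagel => phi _; exact: ellA_sumE.
Qed.

Let rnormE_ge0 phi x i j : 0 <= (rnorm (phi i (x j)))%:E.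
Proof. by rewrite lee_fin rnorm_ge0. Qed.

Lemma mixed_norm_le_ellA phi x : lpnorm r (fun i => opnorm (phi i)) <= 1 ->
  mixed_norm phi x <= ellA_norm s q r x.
Proof.
by move=> phi1; rewrite ellA_normE; apply: ereal_sup_ubound; exists phi.
Qed.

Lemma ellA_norm_le x C :
  (forall phi, lpnorm r (fun i => opnorm (phi i)) <= 1 ->
    mixed_norm phi x <= C) ->
  ellA_norm s q r x <= C.
Proof.
move=> h; rewrite ellA_normE.
by apply: ge_ereal_sup => _ [phi phi1 <-]; exact: h.
Qed.

Lemma mixed_norm_ge0 phi x : 0 <= mixed_norm phi x.
Proof. exact: lpnorm_ge0. Qed.

Lemma mixed_normD phi x y :
  mixed_norm phi (x + y)%R <= mixed_norm phi x + mixed_norm phi y.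
Proof.
apply: le_trans (lpnormD q_ge1 _ _) => [|j|j]; [|exact: lpnorm_ge0..].
apply: le_lpnorm => [|j|j]; [exact: ltW|exact: lpnorm_ge0|].
apply: le_trans (lpnormD s_ge1 _ _) => [|i|i]; [|exact: rnormE_ge0..].
apply: le_lpnorm => [|i|i]; [exact: ltW|exact: rnormE_ge0|].
rewrite -EFinD lee_fin.
have -> : phi i ((x + y)%R j) = (phi i (x j) + phi i (y j))%R by exact: linearD.
exact: ler_rnormD.
Qed.

Lemma mixed_normZ phi (c : K) x :
  mixed_norm phi (c *: x)%R = (rpart `|c|)%:E * mixed_norm phi x.
Proof.
have c0 : (0 <= rpart `|c|)%R by rewrite -(@ofR_le R k) ofR0 rpartK.
rewrite /mixed_norm -lpnormZ//; last by move=> j; exact: lpnorm_ge0.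
congr lpnorm; apply/funext => j; rewrite -lpnormZ//.
congr lpnorm; apply/funext => i; rewrite -EFinM -rnormZ; congr ((rnorm _)%:E).
exact: linearZ.
Qed.

Lemma mixed_norm_scale phi psi (c : R) x : (0 <= c)%R ->
  (forall i v, rnorm (psi i v) = c * rnorm (phi i v))%R ->
  mixed_norm psi x = c%:E * mixed_norm phi x.
Proof.
move=> c0 psiE; rewrite /mixed_norm -lpnormZ//; last first.
  by move=> j; exact: lpnorm_ge0.
congr lpnorm; apply/funext => j; rewrite -lpnormZ//.
by congr lpnorm; apply/funext => i; rewrite psiE.
Qed.

Lemma inner_norm_truncate phi x n j :
  lpnorm s (fun i => (rnorm (phi i (truncate x n j)))%:E) =
  if (j < n)%N then lpnorm s (fun i => (rnorm (phi i (x j)))%:E) else 0.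
Proof.
rewrite /truncate; case: ifP => // _.
rewrite (@lpnorm_single _ _ _ 0%N)// ?linear0 ?rnorm0// => i _.
by rewrite linear0 rnorm0.
Qed.

Lemma mixed_norm_truncate_le phi x n :
  mixed_norm phi (truncate x n) <= mixed_norm phi x.
Proof.
apply: le_lpnorm => [|j|j]; [exact: ltW|exact: lpnorm_ge0|].
by rewrite inner_norm_truncate; case: ifP => // _; exact: lpnorm_ge0.
Qed.

(** Only the inner norm at [j] survives. It is at most [rnorm v] times the l_s norm of the
    [opnorm (phi i)], and [r <= s] bounds that factor by 1. *)
Lemma mixed_norm_delta phi j (v : E) :
  lpnorm r (fun i => opnorm (phi i)) <= 1 ->
  mixed_norm phi (delta_seq j v) <= (rnorm v)%:E.
Proof.
move=> phi1; rewrite /mixed_norm (@lpnorm_single _ _ _ j)//; first last.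
- exact: lpnorm_ge0.
- move=> n /negbTE nj; rewrite /delta_seq nj.
  rewrite (@lpnorm_single _ _ _ 0%N)// ?linear0 ?rnorm0// => i _.
  by rewrite linear0 rnorm0.
rewrite /delta_seq eqxx.
apply: (@le_trans _ _ (lpnorm s (fun i => (rnorm v)%:E * opnorm (phi i)))).
  apply: le_lpnorm => [|i|i]; [exact: ltW|by rewrite lee_fin rnorm_ge0|].
  by rewrite muleC rnorm_le_opnorm.
rewrite lpnormZ// ?rnorm_ge0//; last by move=> i; exact: opnorm_ge0.
rewrite -[leRHS]mule1; apply: lee_wpmul2l; first by rewrite lee_fin rnorm_ge0.
by apply: lpnorm_le1W phi1 => // i; exact: opnorm_ge0.
Qed.

Lemma ellA_normD x y :
  ellA_norm s q r (x + y)%R <= ellA_norm s q r x + ellA_norm s q r y.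
Proof.
apply: ellA_norm_le => phi phi1; apply: le_trans (mixed_normD _ _ _) _.
by apply: leeD; exact: mixed_norm_le_ellA.
Qed.

Lemma ellA_normZ (c : K) x :
  ellA_norm s q r (c *: x)%R <= (rpart `|c|)%:E * ellA_norm s q r x.
Proof.
apply: ellA_norm_le => phi phi1; rewrite mixed_normZ; apply: lee_wpmul2l.
  by rewrite lee_fin -(@ofR_le R k) ofR0 rpartK.
exact: mixed_norm_le_ellA.
Qed.

Lemma ellA_norm_ge_term x j : (rnorm (x j))%:E <= ellA_norm s q r x.
Proof.
have [f f1 fx] := hahn_banach (x j).
(* Scaling by 0 produces the zero functional that fills up the sequence [(f, 0, 0, ...)]. *)
have [z [zE z0]] := clinear_scale f (lexx 0).
pose phi i : dual E := if i == 0%N then f else z.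
have phi1 : lpnorm r (fun i => opnorm (phi i)) <= 1.
  rewrite (@lpnorm_single _ _ _ 0%N)// => [i /negbTE i0|]; last first.
    exact: opnorm_ge0.
  apply/eqP; rewrite eq_le opnorm_ge0 andbT /phi i0.
  by apply: le_trans z0 _; rewrite mul0e.
apply: le_trans (mixed_norm_le_ellA x phi1).
apply: le_trans (lpnorm_ge_term j q0 _) => [|n]; last exact: lpnorm_ge0.
apply: le_trans (lpnorm_ge_term 0 s0 _) => [|n]; last exact: rnormE_ge0.
by rewrite lee_fin.
Qed.

(** For each fixed [phi] the mixed norm is the supremum over truncations, and two suprema
    commute. *)
Lemma ellA_norm_truncate x :
  ellA_norm s q r x = ereal_sup (range (@ellA_norm R k s q r E \o truncate x)).
Proof.
apply/eqP; rewrite eq_le; apply/andP; split.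
  apply: ellA_norm_le => phi phi1; apply: lpnorm_le_truncate => // [j|n].
    exact: lpnorm_ge0.
  apply: (@le_trans _ _ (ellA_norm s q r (truncate x n))); last first.
    by apply: ereal_sup_ubound; exists n.
  apply: le_trans (mixed_norm_le_ellA _ phi1).
  apply: le_lpnorm => [|j|j]; [exact: ltW| |].
    by case: ifP => // _; exact: lpnorm_ge0.
  by rewrite inner_norm_truncate.
apply: ge_ereal_sup => _ [n _ <-] /=; apply: ellA_norm_le => phi phi1.
by apply: le_trans (mixed_norm_truncate_le _ _ _) _; exact: mixed_norm_le_ellA.
Qed.

Lemma ellA_norm_delta j (v : E) :
  ellA_norm s q r (delta_seq j v) <= (rnorm v)%:E.
Proof. by apply: ellA_norm_le => phi; exact: mixed_norm_delta. Qed.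

Definition ellA_sn : seq_normed E :=
  SeqNormed ellA_normD (fun c x _ => ellA_normZ c x) ellA_norm_ge_term
    ellA_norm_truncate ellA_norm_delta.

Lemma mixed_norm_le phi x (c : R) : (0 < c)%R ->
  lpnorm r (fun i => opnorm (phi i)) <= c%:E ->
  mixed_norm phi x <= c%:E * ellA_norm s q r x.
Proof.
move=> c0 phic; have ci0 : (0 <= c^-1)%R by rewrite invr_ge0 ltW.
have [psi psiE] := choice (fun i => clinear_scale (phi i) ci0).
rewrite -lee_pdivrMl// -(mixed_norm_scale x ci0 (fun i => (psiE i).1)).
apply: mixed_norm_le_ellA.
apply: (@le_trans _ _ (lpnorm r (fun i => c^-1%:E * opnorm (phi i)))).
  apply: le_lpnorm => [|i|i]; [exact: ltW|exact: opnorm_ge0|exact: (psiE i).2].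
rewrite lpnormZ//; last by move=> i; exact: opnorm_ge0.
by rewrite lee_pdivrMl// mule1.
Qed.

Lemma ellA_norm_lty_ellA x : ellA_norm s q r x < +oo -> ellA s q r E x.
Proof.
move=> xfin phi phifin.
have fin : lpnorm r (fun i => opnorm (phi i)) \is a fin_num.
  by rewrite ge0_fin_numE ?lpnorm_ge0.
(* The added 1 keeps [c] positive even if all functionals vanish. *)
pose c := (fine (lpnorm r (fun i => opnorm (phi i))) + 1)%R.
have c0 : (0 < c)%R by rewrite ltr_wpDl ?fine_ge0 ?lpnorm_ge0.
have phic : lpnorm r (fun i => opnorm (phi i)) <= c%:E.
  by rewrite EFinD fineK// leeDl.
apply: (@lty_poweRy _ _ q^-1); first by rewrite invr_neq0 ?gt_eqF.
rewrite ellA_sumE; apply: le_lt_trans (mixed_norm_le x c0 phic) _.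
by rewrite lte_mul_pinfty ?lee_fin ?(ltW c0).
Qed.

Lemma sum_half_powers : \sum_(n <oo) ((2 ^ n.+1)%:R^-1 : R)%:E = 1.
Proof.
have /cvg_lim := @cvg_geometric_eseries_half R 1%R 0.
rewrite expr0 divr1 => <-//; apply: congr_lim; apply/funext => n.
by apply: eq_bigr => i _; rewrite addn1 div1r.
Qed.

(* A family [phi n] in the unit ball whose mixed norms at [x] grow too fast,
   scaled by [2 ^- n.+1], is merged into a single sequence of functionals that
   violates the membership of [x]; this replaces the closed graph theorem. *)
Lemma ellA_ellA_norm_lty x : ellA s q r E x -> ellA_norm s q r x < +oo.
Proof.
move=> xA; rewrite ltNge leye_eq; apply/negP => /eqP xoo.
pose a n : R := (2 ^ n.+1)%:R^-1%R.
have a_gt0 n : (0 < a n)%R by rewrite invr_gt0 ltr0n expn_gt0.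
have a_le1 n : (a n <= 1)%R by rewrite invf_le1 ?ler1n ?ltr0n expn_gt0.
(* If no such [phi] existed, [n%:R / a n] would bound the infinite norm of [x]. *)
have big n : exists phi : nat -> dual E,
    lpnorm r (fun i => opnorm (phi i)) <= 1 /\
    n%:R%:E <= (a n)%:E * mixed_norm phi x.
  apply: contrapT => h.
  suff : ellA_norm s q r x <= (n%:R / a n)%:E by rewrite xoo leye_eq.
  apply: ellA_norm_le => phi phi1; rewrite leNgt; apply/negP => hn.
  apply: h; exists phi; split=> //.
  by rewrite -lee_pdivrMl// -EFinM mulrC ltW.
have [phi phiP] := choice big.
have [psi psiE] := choice (fun m : nat * nat =>
  clinear_scale (phi m.1 m.2) (ltW (a_gt0 m.1))).
have [e] : exists e : nat -> nat * nat, set_bij setT setT e.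
  by apply/card_set_bijP; rewrite card_eq_sym; exact: card_nat2.
rewrite setTT_bijective => ebij.
pose Phi m := psi (e m).
have Phi_fin : ell_dual_norm r Phi < +oo.
  apply: poweR_lty; apply: le_lt_trans (ltry 1%R).
  rewrite (nneseries_pair (f := fun m => opnorm (psi m) `^ r) ebij); last first.
    by move=> m; exact: poweR_ge0.
  rewrite -sum_half_powers; apply: lee_nneseries => [n _ _|n _].
    by apply: nneseries_ge0 => *; exact: poweR_ge0.
  rewrite -lpnormX//.
  apply: (@le_trans _ _ (lpnorm r (fun i => (a n)%:E * opnorm (phi n i)) `^ r)).
    apply: lee_poweR; [exact: ltW|exact: lpnorm_ge0|].
    apply: le_lpnorm => [|i|i]; [exact: ltW|exact: opnorm_ge0|].
    exact: (psiE (n, i)).2.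
  rewrite lpnormZ ?(ltW (a_gt0 n))//; last by move=> i; exact: opnorm_ge0.
  apply: (@le_trans _ _ ((a n)%:E `^ r)).
    apply: lee_poweR; first exact: ltW.
      by rewrite mule_ge0 ?lpnorm_ge0// lee_fin ltW.
    rewrite -[leRHS]mule1; apply: lee_wpmul2l; last exact: (phiP n).1.
    by rewrite lee_fin ltW.
  by rewrite lee_fin ge1r_powR// a_gt0 a_le1.
(* The scaled [phi n] is one block of [Phi], and every inner sum over [Phi] dominates the sum over
   that block. *)
have Phi_ge n : (a n)%:E * mixed_norm (phi n) x <= mixed_norm Phi x.
  have psinE i v := (psiE (n, i)).1 v.
  have <- := mixed_norm_scale x (ltW (a_gt0 n)) psinE.
  apply: le_lpnorm => [|j|j]; [exact: ltW|exact: lpnorm_ge0|].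
  apply: lee_poweR; first by rewrite invr_ge0 ltW.
    by apply: nneseries_ge0 => *; exact: poweR_ge0.
  rewrite (nneseries_pair
    (f := fun m => (rnorm (psi m (x j)))%:E `^ s) ebij); last first.
    by move=> m; exact: poweR_ge0.
  apply: (nneseries_ge_term (a := fun n =>
    \sum_(i <oo) (rnorm (psi (n, i) (x j)))%:E `^ s)) => m.
  by apply: nneseries_ge0 => *; exact: poweR_ge0.
have val_fin : mixed_norm Phi x \is a fin_num.
  rewrite ge0_fin_numE ?mixed_norm_ge0// -ellA_sumE.
  by apply: poweR_lty; exact: xA.
(* This index exceeds the finite value of the mixed norm, which however dominates every [n]. *)
have := Phi_ge (Num.truncn (fine (mixed_norm Phi x))).+1.
move=> /(le_trans (phiP _).2).
rewrite -(fineK val_fin) lee_fin leNgt => /negP; apply.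
exact: truncnS_gt.
Qed.

End OneSpace.

(** Evaluating [phi i] along [u \o x] is evaluating [phi i \o u] along [x], and these composites
    have l_r norm at most [opnorm u]. *)
Lemma ellA_norm_comp (U V : banach) (u : clinear U V) (x : nat -> U) :
  ellA_norm s q r x < +oo ->
  ellA_norm s q r (u \o x) <= opnorm u * ellA_norm s q r x.
Proof.
move=> xfin.
have ufin := opnorm_fin_num u.
(* The zero operator is set apart because [mixed_norm_le] divides by the bound. *)
have [u0|un0] := eqVneq (opnorm u) 0.
  rewrite (_ : u \o x = 0%R).
    by rewrite (sn0 (ellA_sn V) : ellA_norm s q r 0%R = 0) u0 mul0e.
  apply/funext => j; apply: rnorm_eq0; apply/eqP; rewrite eq_le rnorm_ge0 andbT.
  by rewrite -lee_fin (le_trans (rnorm_le_opnorm _ _))// u0 mul0e.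
have u0 : (0 < fine (opnorm u))%R.
  by rewrite -lte_fin fineK// lt0e un0 opnorm_ge0.
apply: ellA_norm_le => phi phi1.
have [psi psiE] := choice (fun i => clinear_comp u (phi i)).
have -> : mixed_norm phi (u \o x) = mixed_norm psi x.
  congr lpnorm; apply/funext => j; congr lpnorm; apply/funext => i.
  by rewrite (psiE i).1.
rewrite -(fineK ufin); apply: mixed_norm_le => //.
apply: (@le_trans _ _
    (lpnorm r (fun i => (fine (opnorm u))%:E * opnorm (phi i)))).
  apply: le_lpnorm => [|i|i]; [exact: ltW|exact: opnorm_ge0|].
  by rewrite fineK//; exact: (psiE i).2.
rewrite lpnormZ ?(ltW u0)//; last by move=> i; exact: opnorm_ge0.
by rewrite -[leRHS]mule1 lee_pmul2l.
Qed.

End EllA.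

Theorem proposition2p13 (R : realType) (k : scalar_kind) (s q r : R)
    (s_ge1 : 1 <= s) (q_ge1 : 1 <= q) (r_ge1 : 1 <= r)
    (q_lt_s : q < s) (r_le_s : r <= s) :
  exists X : sequence_class R k,
    [/\ forall E : completeNormedModType (scalars R k),
          range (sc_val X E) = ellA s q r E,
        forall (E : completeNormedModType (scalars R k)) (v : sc_space X E),
          (rnorm v)%:E = ellA_norm s q r (sc_val X E v),
        linearly_stable X
      & finitely_determined X].
Proof.
pose N (E : completeNormedModType (scalars R k)) :=
  ellA_sn s_ge1 q_ge1 r_ge1 r_le_s E.
exists (class_of_sn N); split.
- move=> E; apply/seteqP; split=> x.
    by move=> /range_snseq_val; exact: (ellA_norm_lty_ellA s_ge1 q_ge1 r_ge1).
  move=> xA; apply/range_snseq_val.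
  exact: (ellA_ellA_norm_lty s_ge1 q_ge1 r_ge1 xA).
- by move=> E v; exact: rnorm_snseq.
- by apply: class_of_sn_linearly_stable => U V u x; exact: ellA_norm_comp.
- exact: class_of_sn_finitely_determined.
Qed.
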